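(* Let $d$ be an integer. The negative polynomial Pell equation $$P^2(X)-(X^2+d)\,Q^2(X)=-1$$ has a non-trivial solution with $P(X),Q(X)\in\mathbb{Z}[X]$ if and only if $d=1$.
   Context: A solution is a pair of polynomials $P(X),Q(X)\in\mathbb{Z}[X]$ satisfying the equation identically; it is non-trivial if $Q(X)\neq 0$. *)

(* Defs.v *)
From HB Require Import structures.
From mathcomp Require Import all_boot all_order all_algebra.

Set Implicit Arguments.
Unset Strict Implicit.
Unset Printing Implicit Defensive.

Import GRing.Theory.
Local Open Scope ring_scope.

Definition neg_pell_solution (d : int) (P Q : {poly int}) : Prop :=
  P ^+ 2 - ('X^2 + d%:P) * Q ^+ 2 = -1.

(* Main.v *)
Require Import Defs.
From mathcomp Require Import all_boot all_order all_algebra.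
From mathcomp Require Import ring zify.

(** Write [D = X^2 + d].  Multiplying a solution [P + Q sqrt D] of
    [P^2 - D Q^2 = c] by the element [-X + sqrt D] of norm [-d], or by its
    opposite conjugate [X + sqrt D], gives a solution for the constant [-d c],
    and one of the two choices lowers the degree of [Q].  Since [D(0) = d], the
    step maps [(P(0), Q(0))] to [(d Q(0), P(0))], so for [d <> 0] descent down
    to [Q = 0] shows that [P(0) = 0] or [Q(0) = 0].  For [c = -1] the equation
    at [X = 0] reads [P(0)^2 - d Q(0)^2 = -1], which excludes [Q(0) = 0] and,
    when [P(0) = 0], forces [d = 1]. *)

Set Implicit Arguments.
Unset Strict Implicit.
Unset Printing Implicit Defensive.

Import GRing.Theory Num.Theory.
Local Open Scope ring_scope.

(* The polynomials [P - XQ] and [P + XQ] differ by [2XQ], of degree [deg Q + 1],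
   while their product [d Q^2 + c] has degree at most [2 deg Q]. *)
Lemma pell_descent_size (R : idomainType) (d c : R) (P Q : {poly R}) :
  2%:R != 0 :> R -> Q != 0 -> P ^+ 2 - ('X^2 + d%:P) * Q ^+ 2 = c%:P ->
  (size (P - 'X * Q)%R < size Q)%N \/ (size (P + 'X * Q)%R < size Q)%N.
Proof.
move=> two0 Q0 E.
have sQ : (0 < size Q)%N by rewrite size_poly_gt0.
have prodE : (P - 'X * Q) * (P + 'X * Q) = d *: Q ^+ 2 + c%:P.
  by rewrite -E -mul_polyC; ring.
have diffE : (P + 'X * Q) - (P - 'X * Q) = 2%:R *: ('X * Q).
  by rewrite scaler_nat; ring.
have := congr1 (fun p : {poly R} => size p) diffE.
rewrite /= size_scale // mulrC size_mulX // => sd.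
have := size_polyD (P + Q * 'X) (- (P - Q * 'X)).
rewrite size_polyN sd => sm.
have sp : (size (d *: Q ^+ 2 + c%:P)%R <= (size Q + size Q).-1)%N.
  rewrite (leq_trans (size_polyD _ _)) // geq_max; apply/andP; split.
    by rewrite (leq_trans (size_scale_leq _ _)) // expr2 size_polyMleq.
  by rewrite (leq_trans (size_polyC_leq1 _)) //; lia.
move: sp; rewrite -prodE ['X * Q]mulrC.
have [->|n1] := eqVneq (P - Q * 'X) 0; first by left; rewrite size_poly0.
have [->|n2] := eqVneq (P + Q * 'X) 0; first by right; rewrite size_poly0.
rewrite size_mul // => sp.
move: n1 n2 sQ sm sp; rewrite -!size_poly_gt0.
(* Now [a + b <= 2 * q] and [q + 1 <= maxn a b], so the smaller of [a] and [b] is at most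
   [q - 1]. *)
move: (size (P - Q * 'X)%R) (size (P + Q * 'X)%R) (size Q) => a b q.
lia.
Qed.

Lemma pell_horner0 (R : idomainType) (d c : R) (P Q : {poly R}) :
  2%:R != 0 :> R -> d != 0 -> P ^+ 2 - ('X^2 + d%:P) * Q ^+ 2 = c%:P ->
  P.[0] = 0 \/ Q.[0] = 0.
Proof.
move=> two0 d0; have [n] := ubnP (size Q).
(* The constant [c] must vary in the induction: each descent step multiplies it by [- d]. *)
elim: n => // n IH in c P Q *; rewrite ltnS => sQ E.
have [->|Q0] := eqVneq Q 0; first by right; rewrite horner0.
have step (P' Q' : {poly R}) : (size Q' < size Q)%N ->
    P' ^+ 2 - ('X^2 + d%:P) * Q' ^+ 2 = (- d * c)%:P ->
    P'.[0] = d * Q.[0] -> Q'.[0] = P.[0] -> P.[0] = 0 \/ Q.[0] = 0.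
  move=> sQ' E' P'0 <-; case: (IH _ P' Q' (leq_trans sQ' sQ) E'); last by left.
  by rewrite P'0 => /eqP; rewrite mulf_eq0 (negPf d0) => /eqP; right.
have [s|s] := pell_descent_size two0 Q0 E.
- apply: (step (('X^2 + d%:P) * Q - 'X * P) _ s).
  + by rewrite polyCM -E polyCN; ring.
  + by rewrite !hornerE; ring.
  + by rewrite !hornerE; ring.
- apply: (step (('X^2 + d%:P) * Q + 'X * P) _ s).
  + by rewrite polyCM -E polyCN; ring.
  + by rewrite !hornerE; ring.
  + by rewrite !hornerE; ring.
Qed.

Theorem theorem1p2 (d : int) :
  (exists P Q : {poly int}, neg_pell_solution d P Q /\ Q <> 0) <-> d = 1.
Proof.
split=> [[P [Q [E _]]]|->]; last first.
  exists 'X, 1; split; first by rewrite /neg_pell_solution; ring.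
  by apply/eqP; exact: oner_neq0.
have E0 : P.[0] ^+ 2 - d * Q.[0] ^+ 2 = -1.
  have := congr1 (fun p => p.[0]) E.
  by rewrite /= !hornerE => <-; ring.
(* For [d = 0] the value at 0 would make [-1] an integer square. *)
have d0 : d != 0 by apply/eqP => d0; move: E0; rewrite d0; nia.
have Ec : P ^+ 2 - ('X^2 + d%:P) * Q ^+ 2 = (-1)%:P by rewrite polyCN.
have [P0|Q0] := pell_horner0 (isT : 2%:R != 0 :> int) d0 Ec; move: E0.
  (* With [P.[0] = 0], [d] is a unit with nonnegative inverse [s], hence 1. *)
  rewrite P0; have := sqr_ge0 Q.[0]; move: (Q.[0] ^+ 2) => s s0 E0.
  have ds : d * s = 1 by lia.
  have s1 : 1 <= s by nia.
  nia.
by rewrite Q0; nia.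
Qed.
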